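(* For every $\delta'>0$, the Bipartite Iterative Scaling algorithm (defined in the context) generates $\{B^t_{(j,k)}\}$ satisfying $$\sum_{j\in\Gamma}\|B^t_{(j,k_j)}\mathbf 1-\mu_j\|_1+\sum_{j\in V\setminus\Gamma}\ \sum_{k\in N(j)}\|q^t_{(j,k)}-\bar q^t_j\|_1\le\delta'$$ within $$t=2+\frac{88\,|E|\,C_\infty}{\delta'\,\epsilon}$$ iterations, where $q^t_{(j,k)}=B^t_{(j,k)}\mathbf 1$ and $\bar q^t_j=\frac1{|N(j)|}\sum_{k\in N(j)}q^t_{(j,k)}$.
   Context: Setting. $G=(V,E)$ is a finite tree (each undirected edge is counted once in $E$; both orientations $(j,k)$, $(k,j)$ are used as indices), $N(j)$ is the set of neighbours of $j$. $\Gamma\subset V$ is a set of leaves, no two of which are adjacent; for $j\in\Gamma$, $k_j$ is its unique neighbour and $\mu_j\in\mathbb R_+^d$ is a given probability vector. $C_{(j,k)}\in\mathbb R^{d\times d}$ are transport cost matrices with $C_{(k,j)}=C_{(j,k)}^\top$; $C_\infty=\max_{(j,k)\in E}\|C_{(j,k)}\|_\infty$ (largest absolute value of an entry). $\epsilon>0$, $K_{(j,k)}=\exp(-C_{(j,k)}/\epsilon)$ entrywise, $\gamma_j=\mu_j$ if $j\in\Gamma$ and $\gamma_j=\mathbf 1$ (all-ones vector) otherwise. $\odot$, $./$ and powers of vectors are entrywise, $\bigodot$ is an entrywise product, and $\|\cdot\|_1$ is the sum of absolute values of the entries. Bipartite Iterative Scaling algorithm. Let $V=S_1\sqcup S_2$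 be the bipartition of the tree (every edge joins $S_1$ and $S_2$). Start with $u^0_{(j,k)}=\mathbf 1\in\mathbb R^d$ for every ordered pair of adjacent nodes. At each iteration $t\to t+1$ ($t=0,1,2,\dots$), let $S$ be $S_1$ and $S_2$ alternately, starting with $S_1$. Put $B^t_{(j,k)}=\operatorname{diag}(u^t_{(j,k)}\odot\gamma_j)K_{(j,k)}\operatorname{diag}(u^t_{(k,j)}\odot\gamma_k)$, $q^t_{(j,k)}=B^t_{(j,k)}\mathbf 1$, $q^{t+1}_j=\big(\bigodot_{k\in N(j)}q^t_{(j,k)}\big)^{1/|N(j)|}$, and update $u^{t+1}_{(j,k_j)}=u^t_{(j,k_j)}\odot\mu_j\,./\,q^t_{(j,k_j)}$ for $j\in\Gamma\cap S$; $u^{t+1}_{(j,k)}=u^t_{(j,k)}\odot\frac{q^{t+1}_j}{\|q^{t+1}_j\|_1}\,./\,q^t_{(j,k)}$ for $j\in(V\setminus\Gamma)\cap S$, $k\in N(j)$; all other $u$ are unchanged. (At coordinates where $\mu_j$ vanishes, $u^{t+1}_{(j,k_j)}$ is understood as the corresponding entry of $\mathbf 1./(K_{(j,k_j)}u^t_{(k_j,j)})$, which equals the given expression where $\mu_j>0$.) The iterates are those with $t=1,2,\dots$, and the algorithm stops once the quantity on the left-hand side of the claimed inequality falls below $\delta'$, which is tested for $t\ge1$. *)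

(* Defs.v *)
From HB Require Import structures.
From mathcomp Require Import all_boot all_order all_algebra.
From mathcomp Require Import reals sequences exp.

Set Implicit Arguments.
Unset Strict Implicit.
Unset Printing Implicit Defensive.

Import Order.TTheory GRing.Theory Num.Theory.
Local Open Scope ring_scope.

Section Graph.
Context {V : finType}.
Implicit Types (e : rel V) (j k : V).

Definition nbhd e j : {set V} := [set k | e j k].

Definition edges e : {set {set V}} :=
  [set [set p.1; p.2] | p : V * V & e p.1 p.2].

(* [ucycle e c] with [size c <= 2] is not a graph-theoretic cycle: it is empty,
   a single vertex or an edge traversed back and forth. *)
Definition acyclic e := forall c : seq V, ucycle e c -> (size c <= 2)%N.

Definition is_tree e : Prop :=
  [/\ (0 < #|V|)%N, symmetric e, irreflexive e,
      (forall j k, connect e j k) & acyclic e].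

Definition is_leaf e j : bool := #|nbhd e j| == 1%N.

(* The default value [j] is never used for a leaf. *)
Definition leaf_nbr e j : V := odflt j [pick k in nbhd e j].

Definition is_bipartition e (S1 S2 : {set V}) : Prop :=
  [/\ S1 :|: S2 = [set: V], S1 :&: S2 = set0
    & forall j k, e j k ->
        (j \in S1 /\ k \in S2) \/ (j \in S2 /\ k \in S1)].

End Graph.

Section Vectors.
Context {R : realType} {d : nat}.
Implicit Types x y : 'cV[R]_d.

Definition ones : 'cV[R]_d := const_mx 1.
Definition hmul x y : 'cV[R]_d := \col_i (x i 0 * y i 0).
Definition hdiv x y : 'cV[R]_d := \col_i (x i 0 / y i 0).
Definition diag x : 'M[R]_d := diag_mx x^T.
Definition norm1 x : R := \sum_i `|x i 0|.
Definition is_prob x : Prop := (forall i, 0 <= x i 0) /\ \sum_i x i 0 = 1.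

(* Largest absolute value of an entry, not an operator norm. *)
Definition mx_maxabs (A : 'M[R]_d) : R :=
  \big[Num.max/0]_i \big[Num.max/0]_j `|A i j|.

End Vectors.

Section Algorithm.
Context {R : realType} {d : nat} {V : finType}.
Variables (e : rel V) (Gamma : {set V}) (mu : V -> 'cV[R]_d).
Variables (C : V -> V -> 'M[R]_d) (eps : R).

Definition Cmax : R :=
  \big[Num.max/0]_(p : V * V | e p.1 p.2) mx_maxabs (C p.1 p.2).

Definition Kmx j k : 'M[R]_d := map_mx (fun c => expR (- c / eps)) (C j k).

Definition gam j : 'cV[R]_d := if j \in Gamma then mu j else ones.

(* A family of scalings assigns a vector to every ordered pair of vertices;
   only its values at adjacent pairs are meaningful. *)
Definition scaling := V -> V -> 'cV[R]_d.
Implicit Types u : scaling.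

Definition Bmx u j k : 'M[R]_d :=
  diag (hmul (u j k) (gam j)) *m Kmx j k *m diag (hmul (u k j) (gam k)).

Definition qvec u j k : 'cV[R]_d := Bmx u j k *m ones.

Definition qgeo u j : 'cV[R]_d :=
  \col_i (\prod_(k in nbhd e j) qvec u j k i 0) `^ (#|nbhd e j|%:R^-1).

Definition qbar u j : 'cV[R]_d :=
  #|nbhd e j|%:R^-1 *: \sum_(k in nbhd e j) qvec u j k.

(* Where [mu j] vanishes so does [qvec u j k], and the quotient
   [u * mu / q] is replaced by its continuous extension. *)
Definition leaf_update u j k : 'cV[R]_d :=
  \col_i (if mu j i 0 == 0 then ((Kmx j k *m u k j) i 0)^-1
          else hdiv (hmul (u j k) (mu j)) (qvec u j k) i 0).

Definition inner_update u j k : 'cV[R]_d :=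
  hdiv (hmul (u j k) ((norm1 (qgeo u j))^-1 *: qgeo u j)) (qvec u j k).

Definition bis_step (S : {set V}) u : scaling := fun j k =>
  if (j \in S) && e j k then
    if j \in Gamma then leaf_update u j k else inner_update u j k
  else u j k.

Fixpoint bis (S1 S2 : {set V}) (t : nat) : scaling :=
  if t is t'.+1 then bis_step (if odd t' then S2 else S1) (bis S1 S2 t')
  else fun _ _ => ones.

Definition bis_error u : R :=
  \sum_(j in Gamma) norm1 (Bmx u j (leaf_nbr e j) *m ones - mu j)
  + \sum_(j in ~: Gamma) \sum_(k in nbhd e j) norm1 (qvec u j k - qbar u j).

End Algorithm.

(* Main.v *)
Require Import Defs.
From HB Require Import structures.
From mathcomp Require Import classical_sets topology normedtype derive realfun.
From mathcomp Require Import all_boot all_order all_algebra.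
From mathcomp Require Import reals sequences exp.
From mathcomp Require Import ring lra.

(* The potential [- sum <mu_j, ln u_(j, k_j)> - sum ln c_j], where the scalings
   [u_(j, k)] at an inner vertex [j] multiply to the constant vector [c_j],
   decreases at each step by a sum of relative entropies, hence by at least
   [error ^ 2 / (8 |E|)] (Pinsker).  By Gibbs' inequality for the couplings, and
   because [ln u] stays within [2 C_oo / eps] of a constant vector, the potential
   gap from an iterate to any later one is at most [4 C_oo / eps * error].  Using
   the last iterate as reference point avoids the existence of an optimal
   coupling.  Together, the two bounds show that the error exceeds [delta] in at
   most [64 |E| C_oo / (delta eps)] steps before it first falls below it. *)

Set Implicit Arguments.
Unset Strict Implicit.
Unset Printing Implicit Defensive.

Import Order.TTheory GRing.Theory Num.Theory.
Import numFieldNormedType.Exports.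
Local Open Scope ring_scope.

(** * Pinsker's inequality *)

Section Pinsker.
Context {R : realType}.
Implicit Types x p q : R.

(** By partial fractions the difference of the two sides is [g x - g 1], and [g'] has the sign of
    [(y - 1) ^ 3], so [g] is minimal at 1. After clearing denominators, this bound is exactly
    [kl_pointwise] at [q = 1]. *)
Lemma ln_pade x : 0 < x -> (x - 1) * (5 * x + 1) / (2 * x * (x + 2)) <= ln x.
Proof.
move=> x0.
pose g (y : R) := ln y + (4^-1 * y^-1 + 27 / 4 * (y + 2)^-1).
pose g' y : R := y^-1 + (4^-1 * (- y ^- 2) + 27 / 4 * (- (y + 2) ^- 2)).
have g1 : g 1 = 5 / 2 by rewrite /g ln1; field.
have gE : ln x - (x - 1) * (5 * x + 1) / (2 * x * (x + 2)) = g x - g 1.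
  by rewrite g1 /g; field; lra.
have dg (y : R) : 0 < y -> is_derive y 1 g (g' y).
  move=> y0; have y2 : y + 2 != 0 by lra.
  have yn0 : y != 0 by lra.
  have dln := is_derive1_ln y0.
  have d1 := is_deriveV yn0 (is_derive_id y 1).
  have d2 := @is_deriveV R (fun z => z + 2) y _ _ y2 _.
  apply: is_derive_eq; rewrite /g' /GRing.scale/=; field; lra.
have g'E (y : R) : 0 < y -> g' y * (y ^+ 2 * (y + 2) ^+ 2) = (y - 1) ^+ 3.
  by move=> y0; rewrite /g'; field; lra.
have cg (a b : R) : 0 < a -> ({within `[a, b], continuous g})%classic.
  move=> a0; apply: derivable_within_continuous => y; rewrite in_itv/= => /andP[ay _].
  by have := dg _ (lt_le_trans a0 ay) => /@ex_derive.
have g'p (y : R) : 0 < y -> (0 <= g' y) = (0 <= (y - 1) ^+ 3).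
  move=> y0; rewrite -g'E// pmulr_lge0// mulr_gt0// exprn_gt0//; lra.
have g'n (y : R) : 0 < y -> (g' y <= 0) = ((y - 1) ^+ 3 <= 0).
  move=> y0; rewrite -g'E// pmulr_lle0// mulr_gt0// exprn_gt0//; lra.
rewrite -subr_ge0 gE; have [x1|x1] := leP 1 x.
  have [y|c] := @MVT_segment R g g' _ _ x1 _ (cg _ _ ltr01).
    by rewrite in_itv/= => /andP[y1 _]; apply: dg; lra.
  rewrite in_itv/= => /andP[c1 _] ->.
  have : 0 <= g' c by rewrite g'p ?exprn_ge0//; lra.
  by move=> ?; rewrite !mulr_ge0//; lra.
have [y|c] := @MVT_segment R g g' _ _ (ltW x1) _ (cg _ _ x0).
  by rewrite in_itv/= => /andP[y1 _]; apply: dg; lra.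
rewrite in_itv/= => /andP[c1 c2] E.
have : g' c <= 0 by rewrite g'n; [|lra]; rewrite exprn_odd_le0//; lra.
by move=> ?; rewrite -opprB E oppr_ge0 mulr_le0_ge0//; lra.
Qed.

(* Pointwise form of Pinsker's inequality, exact to second order at [p = q]. *)
Lemma kl_pointwise p q : 0 <= p -> 0 <= q -> (q = 0 -> p = 0) ->
  3 * (p - q) ^+ 2 <= (2 * p + 4 * q) * (p * (ln p - ln q) - p + q).
Proof.
move=> p0 q0 qp; have [q1|q1] := eqVneq q 0.
  by rewrite (qp q1) q1; lra.
have [p1|p1] := eqVneq p 0; first by rewrite p1; nra.
have pp : 0 < p by rewrite lt_def p1.
have qq : 0 < q by rewrite lt_def q1.
have xp : 0 < p / q by rewrite divr_gt0.
have := ln_pade xp; rewrite ln_div//.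
set L := ln p - ln q => H.
have := xp; set x := p / q in H * => x0.
have pE : p = x * q by rewrite /x divfK.
(* Both sides are homogeneous of degree 2 in [p] and [q], so only the ratio [x] matters. *)
suff K : 3 * (x - 1) ^+ 2 <= (2 * x + 4) * (x * L - x + 1).
  rewrite pE; have -> : 3 * (x * q - q) ^+ 2 = q ^+ 2 * (3 * (x - 1) ^+ 2) by ring.
  have -> : (2 * (x * q) + 4 * q) * (x * q * L - x * q + q) =
    q ^+ 2 * ((2 * x + 4) * (x * L - x + 1)) by ring.
  by rewrite ler_wpM2l// sqr_ge0.
have : (x - 1) * (5 * x + 1) <= L * (2 * x * (x + 2)) by rewrite -ler_pdivrMr//; nra.
lra.
Qed.

(** Cauchy-Schwarz without square roots: weighted AM-GM gives [amgm], and the weights [l = s],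
    [m = B] or [l = D], [m = s] turn it into the claim times [B] or [D]. *)
Lemma sum_normr_sqr (I : finType) (P : pred I) (a b c : I -> R) :
    (forall i, P i -> 0 <= b i) -> (forall i, P i -> 0 <= c i) ->
    (forall i, P i -> a i ^+ 2 <= b i * c i) ->
  (\sum_(i | P i) `|a i|) ^+ 2 <= (\sum_(i | P i) b i) * \sum_(i | P i) c i.
Proof.
move=> b0 c0 abc; set s := \sum_(i | P i) `|a i|.
set B := \sum_(i | P i) b i; set D := \sum_(i | P i) c i.
have B0 : 0 <= B by exact: sumr_ge0.
have D0 : 0 <= D by exact: sumr_ge0.
have s0 : 0 <= s by exact: sumr_ge0.
have amgm (l m : R) : 0 <= l -> 0 <= m -> 2 * l * m * s <= l ^+ 2 * B + m ^+ 2 * D.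
  move=> l0 m0; rewrite !mulr_sumr -big_split/=; apply: ler_sum => i Pi.
  rewrite -(@ler_pXn2r _ 2)// ?nnegrE ?addr_ge0 ?mulr_ge0 ?sqr_ge0 ?b0 ?c0//.
  have := abc _ Pi; rewrite -(real_normK (num_real (a i))) => H.
  have := ler_wpM2l (mulr_ge0 (sqr_ge0 l) (sqr_ge0 m)) H.
  have := sqr_ge0 (l ^+ 2 * b i - m ^+ 2 * c i); lra.
have [B1|B1] := eqVneq B 0; last first.
  have {}B1 : 0 < B by rewrite lt_def B1.
  by rewrite -(ler_pM2l B1); have := amgm s B s0 B0; lra.
have [D1|D1] := eqVneq D 0; last first.
  have {}D1 : 0 < D by rewrite lt_def D1.
  by rewrite -(ler_pM2l D1); have := amgm D s D0 s0; lra.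
have := amgm 1 1 ler01 ler01; rewrite B1 D1 => H.
have -> : s = 0 by lra.
lra.
Qed.

(** Cauchy-Schwarz applied to [kl_pointwise]: the factors [(2 p + 4 q) / 3] sum to 2, and the
    correction [- p + q], which makes each entropy term nonnegative, sums to 0. *)
Lemma pinsker (I : finType) (p q : I -> R) :
    (forall i, 0 <= p i) -> (forall i, 0 <= q i) ->
    (forall i, q i = 0 -> p i = 0) -> \sum_i p i = 1 -> \sum_i q i = 1 ->
  (\sum_i `|p i - q i|) ^+ 2 <= 2 * \sum_i p i * (ln (p i) - ln (q i)).
Proof.
move=> p0 q0 qp p1 q1.
have D0 i : 0 <= p i * (ln (p i) - ln (q i)) - p i + q i.
  have := kl_pointwise (p0 i) (q0 i) (qp i).
  have [q2|q2] := eqVneq (q i) 0; first by rewrite (qp i q2) q2; lra.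
  have {}q2 : 0 < q i by rewrite lt_def q2 q0.
  have := p0 i; set L := ln _ - ln _ => pi0 H.
  have : 0 <= (2 * p i + 4 * q i) * (p i * L - p i + q i).
    by apply: le_trans H; rewrite mulr_ge0 ?sqr_ge0.
  by rewrite pmulr_rge0//; lra.
have -> : 2 * (\sum_i p i * (ln (p i) - ln (q i))) =
    (\sum_i (2 * p i + 4 * q i) / 3) *
    \sum_i (p i * (ln (p i) - ln (q i)) - p i + q i).
  by rewrite -mulr_suml !big_split/= -!mulr_sumr sumrN p1 q1; field.
apply: (@sum_normr_sqr _ predT (fun i => p i - q i)
  (fun i => (2 * p i + 4 * q i) / 3)) => // i _.
  by have := p0 i; have := q0 i; lra.
by have := kl_pointwise (p0 i) (q0 i) (qp i); lra.
Qed.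

End Pinsker.

(** * Sums of logarithms and deviations from a mean *)

Section Vector.
Context {R : realType} {I : finType}.

Lemma ln_prod_set (A : {set I}) (f : I -> R) : (forall k, 0 < f k) ->
  ln (\prod_(k in A) f k) = \sum_(k in A) ln (f k).
Proof.
move=> f0; suff [] : ln (\prod_(k in A) f k) = \sum_(k in A) ln (f k) /\
    0 < \prod_(k in A) f k by [].
apply: (big_rec2 (fun x y : R => ln x = y /\ 0 < x)) => [|k x y _ [<- x0]].
  by rewrite ln1.
by rewrite lnM ?posrE// mulr_gt0.
Qed.

(** Triangle inequality through [p]: the mean of the [q k] is no farther from [p] than the [q k] are
    on average. *)
Lemma sum_dist_mean_le (J : finType) (A : {set J}) (q : J -> I -> R) (p : I -> R) :
  \sum_(k in A) \sum_i `|q k i - #|A|%:R^-1 * \sum_(l in A) q l i| <=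
  2 * \sum_(k in A) \sum_i `|q k i - p i|.
Proof.
have [->|A0] := eqVneq A set0; first by rewrite !big_set0 mulr0.
have n0 : (0 : R) < #|A|%:R by rewrite ltr0n card_gt0.
pose m i := #|A|%:R^-1 * \sum_(l in A) q l i.
have H : \sum_(k in A) \sum_i `|p i - m i| <= \sum_(k in A) \sum_i `|q k i - p i|.
  rewrite sumr_const exchange_big/= -sumrMnl; apply: ler_sum => i _.
  have -> : `|p i - m i| *+ #|A| = `|\sum_(k in A) (p i - q k i)|.
    rewrite sumrB sumr_const -mulr_natr -[X in _ * X]normr_nat -normrM mulrBl mulr_natr.
    by rewrite /m mulrC mulVKf ?gt_eqF.
  by apply: le_trans (ler_norm_sum _ _ _) _; apply: ler_sum => k _; rewrite distrC.
rewrite mulr_natl mulr2n.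
apply: le_trans (lerD (lexx _) H); rewrite -big_split/=; apply: ler_sum => k _.
by rewrite -big_split/=; apply: ler_sum => i _; exact: ler_distD.
Qed.

(** Since [a] sums to 0, [x] may be shifted by [c]. *)
Lemma sum_centered_le (a x : I -> R) (c M : R) :
    \sum_i a i = 0 -> (forall i, `|x i - c| <= M) ->
  \sum_i a i * x i <= (\sum_i `|a i|) * M.
Proof.
move=> a0 xc.
have -> : \sum_i a i * x i = \sum_i a i * (x i - c).
  under [RHS]eq_bigr do rewrite mulrBr.
  by rewrite sumrB -mulr_suml a0 mul0r subr0.
rewrite mulr_suml; apply: ler_sum => i _; apply: le_trans (ler_norm _) _.
by rewrite normrM ler_wpM2l.
Qed.

End Vector.

(** * Counting the steps of a descent *)

(* [phi] below turns the decrease [x - y >= beta * max(1, x^2)] into a decrease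
   by [beta]; it takes its values in [0, 2[. *)
Lemma quadratic_decrease_count (R : realType) (x : nat -> R) (beta : R) (T : nat) :
    0 <= beta -> (forall t, (t <= T)%N -> 0 <= x t) ->
    (forall t, (t < T)%N -> beta <= x t - x t.+1) ->
    (forall t, (t < T)%N -> beta * x t ^+ 2 <= x t - x t.+1) ->
  T%:R * beta <= 2.
Proof.
move=> b0 x0 d1 d2.
pose phi (y : R) := if y <= 1 then y else 2 - y^-1.
have phi_decr y z : 0 <= y -> 0 <= z -> beta <= y - z -> beta * y ^+ 2 <= y - z ->
    beta <= phi y - phi z.
  move=> y0 z0 h1 h2; rewrite /phi.
  (* The case [y <= 1 < z] contradicts [beta <= y - z]. In the two cases with [1 < y], the quadratic
     decrease is divided by [y ^ 2]. *)
  have [y1|y1] := leP y 1; have [z1|z1] := leP z 1; [lra|lra| |].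
    have : beta <= (y - z) / y ^+ 2 by rewrite ler_pdivlMr ?exprn_gt0//; lra.
    move/le_trans; apply; rewrite ler_pdivrMr; last by rewrite exprn_gt0//; lra.
    rewrite -subr_ge0.
    have -> : (2 - y^-1 - z) * y ^+ 2 - (y - z) = (y - 1) * (2 * y - z * (y + 1)).
      by field; lra.
    by rewrite mulr_ge0//; nra.
  have : beta <= (y - z) / y ^+ 2 by rewrite ler_pdivlMr ?exprn_gt0//; lra.
  move/le_trans; apply; have -> : 2 - y^-1 - (2 - z^-1) = (y - z) / (y * z).
    by field; lra.
  rewrite ler_wpM2l; [by []|lra|].
  by rewrite lef_pV2 ?posrE ?mulr_gt0 ?exprn_gt0 ?expr2 ?ler_pM2l; lra.
have phi_le2 y : phi y <= 2.
  by rewrite /phi; have [y1|y1] := leP y 1; [lra|rewrite gerBl invr_ge0; lra].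
have phi_ge0 y : 0 <= y -> 0 <= phi y.
  move=> y0; rewrite /phi; have [//|y1] := leP y 1; rewrite subr_ge0.
  by apply: (@le_trans _ _ 1); [rewrite invf_le1; lra|lra].
suff H t : (t <= T)%N -> t%:R * beta <= phi (x 0%N) - phi (x t).
  apply: le_trans (H _ (leqnn _)) _.
  by have := phi_le2 (x 0%N); have := phi_ge0 _ (x0 _ (leqnn T)); lra.
elim: t => [|t IH] tT; first by rewrite mul0r subrr.
have := phi_decr _ _ (x0 _ (ltnW tT)) (x0 _ tT) (d1 _ tT) (d2 _ tT).
by have := IH (ltnW tT); rewrite -natr1; lra.
Qed.

(** In units of [b * delta], the gap [F t - F T] satisfies the hypotheses of
    [quadratic_decrease_count] with [beta = delta / (a * b)]: the bound [delta < E t] gives the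
    constant decrease, the gap bound the quadratic one. *)
Lemma descent_count (R : realType) (E F : nat -> R) (a b delta : R) (T : nat) :
    0 < delta -> 0 <= a -> 0 <= b ->
    (forall t, (t < T)%N -> delta < E t) ->
    (forall t, (t < T)%N -> E t ^+ 2 <= a * (F t - F t.+1)) ->
    (forall t, (t < T)%N -> F t - F T <= b * E t) ->
  T%:R <= 2 * a * b / delta.
Proof.
move=> delta0 a0 b0 Elt Edec Egap.
case: (posnP T) => [->|T0]; first by rewrite divr_ge0 ?mulr_ge0// ltW.
have sq t : (t < T)%N -> delta ^+ 2 < a * (F t - F t.+1).
  move=> tT; apply: lt_le_trans (Edec _ tT); have := Elt _ tT => H.
  by rewrite ltr_pXn2r// nnegrE; lra.
have {}a0 : 0 < a.
  rewrite lt_def a0 andbT; apply: contraTneq (sq _ T0) => ->.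
  by rewrite mul0r -leNgt sqr_ge0.
have dec t : (t < T)%N -> 0 < F t - F t.+1.
  by move=> /sq H; rewrite -(pmulr_rgt0 _ a0); apply: le_lt_trans H; exact: sqr_ge0.
have gap0 t : (t <= T)%N -> 0 <= F t - F T.
  (* Induction on the distance to [T], where the gap vanishes. *)
  move=> tT; rewrite -(subKn tT); elim: (T - t)%N (leq_subr t T) => [|n IH] nT.
    by rewrite subn0 subrr.
  have nT' : (T - n.+1 < T)%N by rewrite ltn_subrL.
  have := dec _ nT'; rewrite subnSK//; have := IH (ltnW nT); lra.
have {}b0 : 0 < b.
  rewrite lt_def b0 andbT; apply: contraTneq (dec _ T0) => b1.
  have := Egap _ T0; have := gap0 _ T0; rewrite b1 mul0r -leNgt; lra.
pose s := b * delta; have s0 : 0 < s by rewrite mulr_gt0.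
have as0 : 0 < a * b by rewrite mulr_gt0.
have H : T%:R * (delta / (a * b)) <= 2.
  apply: (@quadratic_decrease_count _ (fun t => (F t - F T) / s)).
  - by apply: divr_ge0; exact: ltW.
  - by move=> t tT; rewrite divr_ge0 ?gap0// ltW.
  - move=> t tT; rewrite -mulrBl ler_pdivlMr// /s.
    have -> : delta / (a * b) * (b * delta) = delta ^+ 2 / a by field; lra.
    by rewrite ler_pdivrMr// opprB addrA subrK [leRHS]mulrC ltW// sq.
  - move=> t tT; rewrite -mulrBl ler_pdivlMr// /s.
    have -> : delta / (a * b) * ((F t - F T) / (b * delta)) ^+ 2 * (b * delta) =
      ((F t - F T) / b) ^+ 2 / a by field; lra.
    rewrite ler_pdivrMr// opprB addrA subrK [leRHS]mulrC; apply: le_trans _ (Edec _ tT).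
    have g0 := gap0 _ (ltnW tT); have := Elt _ tT => Et.
    rewrite ler_pXn2r ?nnegrE ?divr_ge0//; [|lra..].
    by rewrite ler_pdivrMr// mulrC Egap.
rewrite ler_pdivlMr//; move: H; rewrite mulrA ler_pdivrMr//; lra.
Qed.

(** * Sums over adjacent pairs in a bipartite graph *)

Section Pairs.
Context {R : realType} {V : finType}.
Variables (e : rel V) (S : {set V}).
Hypothesis sym_e : symmetric e.

(** One side of a bipartition, expressed through [S] alone, so that updates of either side share the
    same lemmas. *)
Definition alternating := forall j k, e j k -> (j \in S) = (k \notin S).

Hypothesis altS : alternating.

Lemma sum_pairs_swap (f : V -> V -> R) :
  \sum_(j in S) \sum_(k in nbhd e j) f j k =
  \sum_(j in ~: S) \sum_(k in nbhd e j) f k j.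
Proof.
rewrite [LHS](exchange_big_dep (mem (~: S)))/= => [|j k jS]; last first.
  by rewrite !inE => ejk; rewrite -(altS ejk).
apply: eq_bigr => k; rewrite inE => kS; apply: eq_bigl => j.
by rewrite !inE sym_e andb_idl// => ekj; rewrite (altS (k := k)) // sym_e.
Qed.

Lemma sum_pairs_split (f : V -> V -> R) :
  \sum_j \sum_(k in nbhd e j) f j k =
  \sum_(j in S) \sum_(k in nbhd e j) (f j k + f k j).
Proof.
rewrite (bigID (mem S))/=; under [RHS]eq_bigr do rewrite big_split.
rewrite big_split/= [X in _ = _ + X]sum_pairs_swap; congr (_ + _).
by apply: eq_bigl => j; rewrite inE.
Qed.

(** Each edge has exactly one end in [S], so forgetting the orientation is injective on the pairs
    that start in [S]. *)
Lemma sum_pairs_edges : (\sum_(j in S) \sum_(k in nbhd e j) 1 <= #|edges e|%:R :> R).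
Proof.
pose P := [set p : V * V | (p.1 \in S) && e p.1 p.2].
have -> : \sum_(j in S) \sum_(k in nbhd e j) 1 = #|P|%:R :> R.
  rewrite pair_big_dep/= sumr_const; congr (_%:R); apply: eq_card => p.
  by rewrite !inE unfold_in/= inE.
rewrite ler_nat.
pose h (p : V * V) := [set p.1; p.2].
have inj : {in P &, injective h}.
  move=> [j k] [j' k']; rewrite /P; rewrite !inE/= => /andP[jS ejk] /andP[j'S ejk'].
  move: (altS ejk) (altS ejk'); rewrite jS j'S => /esym/negbTE kS /esym/negbTE kS'.
  move=> /setP H; have := H j; rewrite !inE eqxx/= => /esym/orP[/eqP jj'|/eqP jk']; last first.
    by rewrite jk' kS' in jS.
  have := H k; rewrite !inE eqxx orbT => /esym/orP[/eqP kj'|/eqP kk'].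
    by rewrite kj' j'S in kS.
  by rewrite jj' kk'.
rewrite -(card_in_image inj); apply: subset_leq_card; apply/subsetP => _ /imageP[p Pp ->].
apply/imsetP; exists p => //; by move: Pp; rewrite !inE => /andP[].
Qed.

(** Cauchy-Schwarz against the constant 1; the factor |E| of the iteration bound originates here. *)
Lemma sum_pairs_sqr_le (D c : V -> V -> R) :
    (forall j k, e j k -> 0 <= D j k) -> (forall j k, e j k -> D j k ^+ 2 <= c j k) ->
  (\sum_(j in S) \sum_(k in nbhd e j) D j k) ^+ 2 <=
  #|edges e|%:R * \sum_(j in S) \sum_(k in nbhd e j) c j k.
Proof.
move=> D0 Dc; have c0 j k : e j k -> 0 <= c j k.
  by move=> /Dc; apply: le_trans; exact: sqr_ge0.
apply: (@le_trans _ _ ((\sum_(j in S) \sum_(k in nbhd e j) 1) *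
    \sum_(j in S) \sum_(k in nbhd e j) c j k)); last first.
  apply: ler_wpM2r; last exact: sum_pairs_edges.
  by apply: sumr_ge0 => j _; apply: sumr_ge0 => k; rewrite inE; exact: c0.
rewrite !pair_big_dep/=.
rewrite [X in X ^+ 2](eq_bigr (fun p => `|D p.1 p.2|)) => [|p /andP[_]]; last first.
  by rewrite inE => ejk; rewrite ger0_norm ?D0.
apply: sum_normr_sqr => //= p /andP[_]; rewrite inE => ejk; first exact: c0.
by rewrite mul1r; exact: Dc.
Qed.

End Pairs.

(** * Marginals, kernel bounds and targets *)

Section Algorithm.
Context {R : realType} {d : nat} {V : finType}.
Variables (e : rel V) (Gamma : {set V}) (mu : V -> 'cV[R]_d).
Variables (C : V -> V -> 'M[R]_d) (eps : R).
Hypotheses (sym_e : symmetric e) (leafG : forall j, j \in Gamma -> is_leaf e j).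
Hypothesis nadjG : forall j k, j \in Gamma -> k \in Gamma -> ~~ e j k.
Hypothesis probmu : forall j, j \in Gamma -> is_prob (mu j).
Hypothesis trC : forall j k, e j k -> C k j = (C j k)^T.
Hypothesis eps_gt0 : 0 < eps.
Implicit Types (u v : @scaling R d V) (j k : V) (i : 'I_d).

Local Notation K := (Kmx C eps).
Local Notation gam := (gam Gamma mu).
Local Notation Bmx := (Bmx Gamma mu C eps).
Local Notation qvec := (qvec Gamma mu C eps).
Local Notation qgeo := (qgeo e Gamma mu C eps).
Local Notation qbar := (qbar e Gamma mu C eps).
Local Notation bis_step := (bis_step e Gamma mu C eps).
Local Notation kappa := (Cmax e C / eps).

(* [qvec u j k] is [u j k * gam j] times the partner factor of [j] towards [k]. *)
Definition partner u j k i : R := \sum_i' K j k i i' * (u k j i' 0 * gam k i' 0).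

(** This is [partner] with the kernel replaced by the all-ones matrix, hence independent of the
    index: the constant to which [partner] is compared. *)
Definition weight u j k : R := \sum_i u k j i 0 * gam k i 0.

Definition positive u := forall j k i, 0 < u j k i 0.

Definition balanced u := forall j, j \notin Gamma ->
  exists c, forall i, \sum_(k in nbhd e j) ln (u j k i 0) = c.

Definition flat u := forall j k, e j k ->
  exists c, forall i, `|ln (u j k i 0) - c| <= 2 * kappa.

(** This need not hold for the initial scalings, but every step establishes it. *)
Definition unit_mass u := forall j k, e j k -> \sum_i qvec u j k i 0 = 1.

(** The common value that the update at [j] gives to all marginals [qvec u j k]; it lets vertices
    inside and outside [Gamma] be treated alike. *)
Definition target u j : 'cV[R]_d :=
  if j \in Gamma then mu j else (norm1 (qgeo u j))^-1 *: qgeo u j.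

Lemma BmxE u j k i i' :
  Bmx u j k i i' = u j k i 0 * gam j i 0 * K j k i i' * (u k j i' 0 * gam k i' 0).
Proof. by rewrite /Bmx /diag mul_mx_diag mul_diag_mx !mxE. Qed.

Lemma qvec_sumE u j k i : qvec u j k i 0 = \sum_i' Bmx u j k i i'.
Proof. by rewrite mxE; apply: eq_bigr => i' _; rewrite [ones _ _]mxE mulr1. Qed.

Lemma qvecE u j k i : qvec u j k i 0 = u j k i 0 * gam j i 0 * partner u j k i.
Proof.
rewrite qvec_sumE mulr_sumr; apply: eq_bigr => i' _.
by rewrite BmxE -!mulrA.
Qed.

Lemma KmxC j k i i' : e j k -> K k j i i' = K j k i' i.
Proof. by move=> ejk; rewrite !mxE (trC ejk) mxE. Qed.

Lemma BmxC u j k i i' : e j k -> Bmx u k j i i' = Bmx u j k i' i.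
Proof. by move=> ejk; rewrite !BmxE (KmxC _ _ ejk); ring. Qed.

Lemma qvec_massC u j k : e j k -> \sum_i qvec u k j i 0 = \sum_i qvec u j k i 0.
Proof.
move=> ejk; under eq_bigr do rewrite qvec_sumE.
rewrite exchange_big/=; apply: eq_bigr => i _; rewrite qvec_sumE.
by apply: eq_bigr => i' _; rewrite BmxC.
Qed.

Lemma kappa_ge0 : 0 <= kappa.
Proof. exact: divr_ge0 (bigmax_ge_id _ _ _ _) (ltW eps_gt0). Qed.

Lemma Kmx_gt0 j k i i' : 0 < K j k i i'.
Proof. by rewrite mxE expR_gt0. Qed.

Lemma Kmx_bounds j k i i' : e j k -> expR (- kappa) <= K j k i i' <= expR kappa.
Proof.
move=> ejk; rewrite mxE !ler_expR -ler_norml normrM normrN normfV (gtr0_norm eps_gt0).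
rewrite ler_pM2r ?invr_gt0//.
apply: le_trans _ (le_bigmax_cond 0 (fun p => mx_maxabs (C p.1 p.2)) (j := (j, k)) ejk).
apply: le_trans _ (le_bigmax 0 (fun i => \big[Num.max/0]_j0 `|C j k i j0|) i).
exact: le_bigmax.
Qed.

Lemma gam_ge0 j i : 0 <= gam j i 0.
Proof.
by rewrite /Defs.gam; case: ifP => [/probmu[]//|_]; rewrite mxE ler01.
Qed.

(** The argument [i] records that the dimension is positive, and is the witness for the all-ones
    vector. *)
Lemma gam_support j (i : 'I_d) : exists i', 0 < gam j i' 0.
Proof.
rewrite /Defs.gam; case: ifP => [/probmu[m0 m1]|_]; last by exists i; rewrite mxE ltr01.
apply/existsP; apply: contraPT m1; rewrite negb_exists => /forallP H.
rewrite big1 => [/esym/eqP|i' _]; first by rewrite oner_eq0.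
by apply/eqP; rewrite eq_le m0 leNgt H.
Qed.

Lemma weight_gt0 u j k (i : 'I_d) : positive u ->
  0 < weight u j k.
Proof.
move=> u0; have [i' gi'] := gam_support k i.
rewrite /weight (bigD1 i')//= ltr_pwDl ?mulr_gt0// sumr_ge0// => i'' _.
by rewrite mulr_ge0 ?gam_ge0// ltW.
Qed.

Lemma partner_bounds u j k i : positive u -> e j k ->
  expR (- kappa) * weight u j k <= partner u j k i
    <= expR kappa * weight u j k.
Proof.
move=> u0 ejk; rewrite !mulr_sumr; apply/andP; split; apply: ler_sum => i' _;
  (apply: ler_wpM2r; first by rewrite mulr_ge0 ?gam_ge0 ?ltW);
  by have /andP[] := Kmx_bounds i i' ejk.
Qed.

Lemma partner_gt0 u j k i : positive u -> 0 < partner u j k i.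
Proof.
move=> u0; have [i' gi'] := gam_support k i.
rewrite /partner (bigD1 i')//= ltr_pwDl ?mulr_gt0 ?Kmx_gt0// sumr_ge0// => i'' _.
by rewrite !mulr_ge0 ?gam_ge0// ltW// Kmx_gt0.
Qed.

(** The kernel entries lie between [expR (- kappa)] and [expR kappa], so [partner] is constant in
    [i] up to such a factor, whatever the scalings. *)
Lemma ln_partner_flat u j k i : positive u -> e j k ->
  `|ln (partner u j k i) - ln (weight u j k)| <= kappa.
Proof.
move=> u0 ejk; have s0 := weight_gt0 j k i u0; have w0 := partner_gt0 j k i u0.
have /andP[lo hi] := partner_bounds i u0 ejk.
rewrite -ln_div ?posrE// ler_norml -[X in X && _]ler_expR -[X in _ && X]ler_expR.
rewrite lnK ?posrE ?divr_gt0//.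
by rewrite ler_pdivlMr// ler_pdivrMr// lo hi.
Qed.

Lemma qvec_ge0 u j k i : positive u -> 0 <= qvec u j k i 0.
Proof.
move=> u0; rewrite qvecE !mulr_ge0 ?gam_ge0//; apply: ltW => //; exact: partner_gt0.
Qed.

Lemma qvec_gt0 u j k i : positive u -> j \notin Gamma -> 0 < qvec u j k i 0.
Proof.
move=> u0 /negbTE jG; rewrite qvecE /Defs.gam jG mxE mulr1.
by rewrite mulr_gt0// partner_gt0.
Qed.

Lemma qgeo_gt0 u j i : positive u -> j \notin Gamma -> 0 < qgeo u j i 0.
Proof.
by move=> u0 jG; rewrite mxE powR_gt0// prodr_gt0// => k _; exact: qvec_gt0.
Qed.

Lemma norm1_qgeo u j : positive u -> j \notin Gamma ->
  norm1 (qgeo u j) = \sum_i qgeo u j i 0.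
Proof.
by move=> u0 jG; apply: eq_bigr => i _; rewrite gtr0_norm ?qgeo_gt0.
Qed.

Lemma norm1_qgeo_gt0 u j (i : 'I_d) : positive u -> j \notin Gamma ->
  0 < norm1 (qgeo u j).
Proof.
move=> u0 jG; rewrite norm1_qgeo// (bigD1 i)//= ltr_pwDl ?qgeo_gt0//.
by rewrite sumr_ge0// => i' _; rewrite ltW// qgeo_gt0.
Qed.

Lemma target_ge0 u j i : positive u -> 0 <= target u j i 0.
Proof.
move=> u0; rewrite /target; case: ifPn => [/probmu[]//|jG].
by rewrite mxE mulr_ge0 ?invr_ge0 ?sumr_ge0// ltW// qgeo_gt0.
Qed.

Lemma sum_target u j (i : 'I_d) : positive u -> \sum_i target u j i 0 = 1.
Proof.
move=> u0; rewrite /target; case: ifPn => [/probmu[]//|jG].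
under eq_bigr do rewrite mxE.
by rewrite -mulr_sumr -norm1_qgeo// mulVf// gt_eqF// norm1_qgeo_gt0.
Qed.

(** The absolute continuity required by Pinsker's inequality: as scalings and partners are positive,
    a zero of the marginal is a zero of [gam j], hence of [mu j]. *)
Lemma target0 u j k i : positive u -> qvec u j k i 0 = 0 -> target u j i 0 = 0.
Proof.
move=> u0; rewrite qvecE => /eqP; rewrite !mulf_eq0.
rewrite (gt_eqF (u0 j k i)) (gt_eqF (partner_gt0 j k i u0)) orbF/=.
rewrite /target /Defs.gam; case: ifP => [_ /eqP//|_].
by rewrite mxE oner_eq0.
Qed.

(** * One step of the algorithm *)

Section Step.
Variables (S : {set V}) (u : @scaling R d V).
Hypotheses (altS : alternating e S) (u_gt0 : positive u) (u_bal : balanced u).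

Lemma step_out j k : j \notin S -> bis_step S u j k = u j k.
Proof. by rewrite /Defs.bis_step => /negbTE ->. Qed.

Lemma step_leaf j k i : j \in S -> e j k -> j \in Gamma ->
  bis_step S u j k i 0 = (partner u j k i)^-1.
Proof.
move=> jS ejk jG; rewrite /Defs.bis_step jS ejk jG/= mxE.
have w0 := partner_gt0 j k i u_gt0; have x0 := u_gt0 j k i.
case: ifPn => m0.
  (* Where [mu j] vanishes, the update inverts the kernel applied to [u k j]; this is [partner]
     because [k] lies outside [Gamma] and [gam k] is all ones. *)
  have kG : k \in Gamma = false by apply/negP => kG; have := nadjG jG kG; rewrite ejk.
  congr (_^-1); rewrite mxE; apply: eq_bigr => i' _.
  by rewrite /Defs.gam kG [ones _ _]mxE mulr1.
rewrite 2!mxE qvecE /Defs.gam jG; field.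
by rewrite m0 !gt_eqF.
Qed.

Lemma step_inner j k i : j \in S -> e j k -> j \notin Gamma ->
  bis_step S u j k i 0 = target u j i 0 / partner u j k i.
Proof.
move=> jS ejk jG; rewrite /Defs.bis_step jS ejk (negbTE jG)/= 2!mxE qvecE.
have w0 := partner_gt0 j k i u_gt0; have x0 := u_gt0 j k i.
have -> : (norm1 (qgeo u j))^-1 *: qgeo u j = target u j by rewrite /target (negbTE jG).
rewrite /Defs.gam (negbTE jG) [ones _ _]mxE; field.
by rewrite !gt_eqF.
Qed.

Lemma step_gt0 : positive (bis_step S u).
Proof.
move=> j k i; rewrite /Defs.bis_step.
have [/andP[jS ejk]|_] := boolP (_ && _); last exact: u_gt0.
have H := partner_gt0 j k i u_gt0.
have [jG|jG] := boolP (j \in Gamma).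
  by have := step_leaf i jS ejk jG; rewrite /Defs.bis_step jS ejk jG => ->; rewrite invr_gt0.
have := step_inner i jS ejk jG; rewrite /Defs.bis_step jS ejk (negbTE jG) => ->.
rewrite divr_gt0// /target (negbTE jG) mxE mulr_gt0 ?invr_gt0 ?qgeo_gt0//.
exact: norm1_qgeo_gt0.
Qed.

(** The neighbours of [j] lie outside [S] and keep their scalings; this is why a step attains the
    new marginal at [j] exactly. *)
Lemma partner_step j k i : j \in S -> e j k ->
  partner (bis_step S u) j k i = partner u j k i.
Proof.
by move=> jS ejk; apply: eq_bigr => i' _; rewrite step_out// -(altS ejk).
Qed.

Lemma qvec_step j k i : j \in S -> e j k ->
  qvec (bis_step S u) j k i 0 = target u j i 0.
Proof.
move=> jS ejk; have w0 := partner_gt0 j k i u_gt0.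
rewrite qvecE partner_step//; have [jG|jG] := boolP (j \in Gamma).
  rewrite step_leaf// /target /Defs.gam jG; field; exact: lt0r_neq0.
rewrite step_inner// /Defs.gam (negbTE jG) [ones _ _]mxE; field; exact: lt0r_neq0.
Qed.

(** Targets have mass 1, each edge has an end in [S], and both marginals of a coupling have the same
    mass. *)
Lemma step_unit_mass (i0 : 'I_d) : unit_mass (bis_step S u).
Proof.
have H j k : e j k -> j \in S -> \sum_i qvec (bis_step S u) j k i 0 = 1.
  move=> ejk jS; under eq_bigr do rewrite qvec_step//.
  exact: sum_target.
move=> j k ejk; have [jS|jS] := boolP (j \in S); first exact: H.
rewrite -qvec_massC// H// 1?sym_e//.
by move: (altS ejk); rewrite (negbTE jS) => /esym/negbFE.
Qed.

(** Of the three factors of the marginal only the scaling changes, so the two log ratios agree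
    wherever the target is nonzero. *)
Lemma target_ln_step j k i : j \in S -> e j k ->
  target u j i 0 * (ln (bis_step S u j k i 0) - ln (u j k i 0)) =
  target u j i 0 * (ln (target u j i 0) - ln (qvec u j k i 0)).
Proof.
move=> jS ejk; have [->|p0] := eqVneq (target u j i 0) 0; first by rewrite !mul0r.
have w0 := partner_gt0 j k i u_gt0; have x0 := u_gt0 j k i.
have y0 := step_gt0 j k i.
have g0 : 0 < gam j i 0.
  rewrite lt_def gam_ge0 andbT; apply: contraNneq p0 => g0.
  by apply/eqP/(target0 (k := k) u_gt0); rewrite qvecE g0 mulr0 mul0r.
rewrite -(qvec_step i jS ejk) !qvecE partner_step// !lnM ?posrE ?mulr_gt0//.
by congr (_ * _); ring.
Qed.

Lemma ln_target j i : j \notin Gamma ->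
  ln (target u j i 0) = #|nbhd e j|%:R^-1 *
    \sum_(k in nbhd e j) (ln (u j k i 0) + ln (partner u j k i)) -
  ln (norm1 (qgeo u j)).
Proof.
move=> jG; rewrite /target (negbTE jG) mxE.
have n0 := norm1_qgeo_gt0 i u_gt0 jG; have q0 := qgeo_gt0 i u_gt0 jG.
rewrite lnM ?posrE ?invr_gt0// lnV ?posrE// addrC; congr (_ - _).
rewrite mxE ln_powR ln_prod_set => [|k]; last exact: qvec_gt0.
congr (_ * _); apply: eq_bigr => k _.
rewrite qvecE /Defs.gam (negbTE jG) [ones _ _]mxE mulr1 lnM ?posrE//.
exact: partner_gt0.
Qed.

(** Balance makes the mean of [ln u] over the neighbours independent of [i]; what remains is a mean
    of terms [ln partner], each within [kappa] of a constant. *)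
Lemma ln_target_flat j : j \notin Gamma ->
  exists c, forall i, `|ln (target u j i 0) - c| <= kappa.
Proof.
move=> jG; have [c Hc] := u_bal jG.
set n : R := #|nbhd e j|%:R.
exists (n^-1 * (c + \sum_(k in nbhd e j) ln (weight u j k)) - ln (norm1 (qgeo u j))).
move=> i; rewrite ln_target// -/n opprB addrA subrK -mulrBr big_split/= Hc.
rewrite opprD addrACA subrr add0r -sumrB normrM ger0_norm ?invr_ge0//.
(* Without neighbours the mean is 0, as the inverse of 0 is 0. *)
have [n0|n0] := eqVneq n 0; first by rewrite n0 invr0 mul0r kappa_ge0.
rewrite mulrC ler_pdivrMr ?lt_def ?n0 ?ler0n//.
apply: le_trans (ler_norm_sum _ _ _) _; rewrite mulr_natr -sumr_const.
by apply: ler_sum => k; rewrite inE => ejk; exact: ln_partner_flat.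
Qed.

(** At a vertex of [Gamma] the new scaling is [1 / partner], which costs one [kappa]; elsewhere it
    is [target / partner], which costs two. *)
Lemma step_flat : flat u -> flat (bis_step S u).
Proof.
move=> u_flat j k ejk; have [jS|jS] := boolP (j \in S); last first.
  by rewrite step_out//; exact: u_flat.
have [jG|jG] := boolP (j \in Gamma).
  exists (- ln (weight u j k)) => i; rewrite step_leaf// lnV ?posrE ?partner_gt0//.
  rewrite opprK addrC distrC (le_trans (ln_partner_flat _ _ _))//.
  by have := kappa_ge0; lra.
have [c Hc] := ln_target_flat jG; exists (c - ln (weight u j k)) => i.
have p0 : 0 < target u j i 0.
  rewrite /target (negbTE jG) mxE mulr_gt0 ?invr_gt0 ?qgeo_gt0//.
  exact: norm1_qgeo_gt0.
rewrite step_inner// ln_div ?posrE ?partner_gt0//.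
by have := Hc i; have := ln_partner_flat i u_gt0 ejk; rewrite !ler_norml; lra.
Qed.

(** The target is proportional to the geometric mean of the [u * partner], so the partners cancel in
    the product of the [target / partner]; only the normalisation shifts the constant. *)
Lemma step_balanced : balanced (bis_step S u).
Proof.
move=> j jG; have [c Hc] := u_bal jG.
have [jS|jS] := boolP (j \in S); last first.
  by exists c => i; rewrite -(Hc i); apply: eq_bigr => k _; rewrite step_out.
exists (c - #|nbhd e j|%:R * ln (norm1 (qgeo u j))) => i.
transitivity (\sum_(k in nbhd e j) (ln (target u j i 0) - ln (partner u j k i))).
  apply: eq_bigr => k; rewrite inE => ejk; rewrite step_inner// ln_div ?posrE ?partner_gt0//.
  rewrite /target (negbTE jG) mxE mulr_gt0 ?invr_gt0 ?qgeo_gt0//.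
  exact: norm1_qgeo_gt0.
rewrite sumrB sumr_const ln_target// big_split/= Hc -[X in X - _]mulr_natl mulrBr.
have [n0|n0] := eqVneq (#|nbhd e j|%:R : R) 0; last first.
  by rewrite mulVKf//; ring.
move: (Hc i); move: n0 => /eqP; rewrite pnatr_eq0 cards_eq0 => /eqP ->.
by rewrite !big_set0 cards0 => <-; ring.
Qed.

End Step.

(** * The error and its reference marginals *)

Definition center u j : 'cV[R]_d := if j \in Gamma then mu j else qbar u j.

Definition pairwise_error u j k : R := \sum_i `|qvec u j k i 0 - center u j i 0|.

Lemma bis_errorE u : bis_error e Gamma mu C eps u =
  \sum_j \sum_(k in nbhd e j) pairwise_error u j k.
Proof.
rewrite [RHS](bigID (mem Gamma))/= /bis_error; congr (_ + _).
  apply: eq_bigr => j jG; have /cards1P[k Hk] := leafG jG.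
  rewrite Hk big_set1 /leaf_nbr; case: pickP => [k'|/(_ k)]/=; rewrite Hk;
    last by rewrite set11.
  move=> /set1P ->.
  by apply: eq_bigr => i _; rewrite /center jG !mxE.
apply: eq_big => [j|j]; first by rewrite in_setC.
rewrite in_setC => jG; apply: eq_bigr => k _.
by apply: eq_bigr => i _; rewrite /center (negbTE jG) !mxE.
Qed.

(** After a step the marginals at a vertex of [S] all equal its target, hence also their mean; the
    remaining error sits outside [S]. *)
Lemma center_step S u j k i : alternating e S -> positive u -> j \in S -> e j k ->
  center (bis_step S u) j i 0 = qvec (bis_step S u) j k i 0.
Proof.
move=> altS u0 jS ejk; rewrite qvec_step// /center.
have [jG|jG] := boolP (j \in Gamma); first by rewrite /target jG.
rewrite !mxE summxE (eq_bigr (fun=> target u j i 0)) => [|l]; last first.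
  by rewrite inE => ejl; rewrite qvec_step.
rewrite sumr_const -[X in _ * X]mulr_natl mulKf// pnatr_eq0 cards_eq0.
by apply/set0Pn; exists k; rewrite inE.
Qed.

Lemma sum_center u j k : unit_mass u -> e j k -> \sum_i center u j i 0 = 1.
Proof.
move=> u1 ejk; rewrite /center; case: ifP => [/probmu[]//|_].
under eq_bigr do rewrite mxE summxE; rewrite -mulr_sumr exchange_big/=.
rewrite (eq_bigr (fun=> 1)) => [|l]; last by rewrite inE => /u1.
rewrite sumr_const mulVf// pnatr_eq0 cards_eq0.
by apply/set0Pn; exists k; rewrite inE.
Qed.

(** * Decrease and gap of the potential *)

Section Potential.
Variable i0 : 'I_d.

(* At a vertex outside [Gamma] any probability vector could be used, since
   [balanced] makes the sum of the logarithms constant. *)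
Definition pivot j i : R := if j \in Gamma then mu j i 0 else (i == i0)%:R.

(* The dual objective, up to the mass terms, which are constant on [unit_mass]. *)
Definition potential u : R :=
  - \sum_j \sum_(k in nbhd e j) \sum_i pivot j i * ln (u j k i 0).

Lemma sum_pivot j : \sum_i pivot j i = 1.
Proof.
rewrite /pivot; have [/probmu[]//|_] := boolP (j \in Gamma).
by rewrite (bigD1 i0)//= eqxx big1 ?addr0// => i /negbTE ->.
Qed.

(** By [balanced], pairing with any vector of mass 1 yields the same constant, so [pivot] can be
    exchanged for weights that suit the estimate at hand. *)
Lemma sum_pivotE u j (m : 'cV[R]_d) : balanced u ->
    (j \in Gamma -> m = mu j) -> (forall k, e j k -> \sum_i m i 0 = 1) ->
  \sum_(k in nbhd e j) \sum_i pivot j i * ln (u j k i 0) =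
  \sum_(k in nbhd e j) \sum_i m i 0 * ln (u j k i 0).
Proof.
move=> u_bal mG m1; have [jG|jG] := boolP (j \in Gamma).
  by rewrite mG// /pivot jG.
have [->|/set0Pn[k]] := eqVneq (nbhd e j) set0; first by rewrite !big_set0.
rewrite inE => /m1 {}m1; have [c Hc] := u_bal _ jG.
have H (f : 'I_d -> R) : \sum_i f i = 1 ->
    \sum_(k in nbhd e j) \sum_i f i * ln (u j k i 0) = c.
  move=> f1; rewrite exchange_big/=.
  rewrite (eq_bigr (fun i => f i * c)) => [|i _]; last by rewrite -mulr_sumr Hc.
  by rewrite -mulr_suml f1 mul1r.
by rewrite !H// sum_pivot.
Qed.

(** The weights [m] are the targets when a step is analysed and the centers when the gap is
    bounded. *)
Lemma potentialB u v (m : V -> 'cV[R]_d) : balanced u -> balanced v ->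
    (forall j, j \in Gamma -> m j = mu j) ->
    (forall j k, e j k -> \sum_i m j i 0 = 1) ->
  potential u - potential v = \sum_j \sum_(k in nbhd e j) \sum_i
    m j i 0 * (ln (v j k i 0) - ln (u j k i 0)).
Proof.
move=> u_bal v_bal mG m1; rewrite /potential opprK addrC -sumrB; apply: eq_bigr => j _.
rewrite !(@sum_pivotE _ _ (m j))//; [|exact: mG|exact: m1|exact: mG|exact: m1].
rewrite -sumrB; apply: eq_bigr => k _; rewrite -sumrB.
by apply: eq_bigr => i _; rewrite mulrBr.
Qed.

Lemma potential_step S u : alternating e S -> positive u -> balanced u ->
  potential u - potential (bis_step S u) =
  \sum_(j in S) \sum_(k in nbhd e j) \sum_i
    target u j i 0 * (ln (target u j i 0) - ln (qvec u j k i 0)).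
Proof.
move=> altS u0 u_bal; rewrite (@potentialB _ _ (target u))//; last 3 first.
- exact: step_balanced.
- by move=> j jG; rewrite /target jG.
- by move=> j k _; exact: sum_target.
rewrite (bigID (mem S))/= [X in _ + X]big1 ?addr0 => [|j jS]; last first.
  by rewrite big1// => k _; rewrite big1// => i _; rewrite step_out// subrr mulr0.
apply: eq_bigr => j jS; apply: eq_bigr => k; rewrite inE => ejk.
by apply: eq_bigr => i _; exact: target_ln_step.
Qed.

(* Gibbs' inequality for the couplings [Bmx u j k] and [Bmx v j k]. *)
Lemma pair_gibbs u v j k : positive u -> positive v -> unit_mass u -> unit_mass v ->
    e j k ->
  0 <= \sum_i qvec u j k i 0 * (ln (u j k i 0) - ln (v j k i 0)) +
       \sum_i qvec u k j i 0 * (ln (u k j i 0) - ln (v k j i 0)).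
Proof.
move=> u0 v0 u1 v1 ejk.
pose x i := ln (u j k i 0) - ln (v j k i 0).
pose y i := ln (u k j i 0) - ln (v k j i 0).
have -> : \sum_i qvec u j k i 0 * x i + \sum_i qvec u k j i 0 * y i =
    \sum_i \sum_i' Bmx u j k i i' * (x i + y i').
  under [RHS]eq_bigr do under eq_bigr do rewrite mulrDr.
  under [RHS]eq_bigr do rewrite big_split/=.
  rewrite big_split/=; congr (_ + _); last rewrite [RHS]exchange_big/=;
    apply: eq_bigr => i _; rewrite qvec_sumE mulr_suml//.
  by apply: eq_bigr => i' _; rewrite BmxC.
have : \sum_i \sum_i' (Bmx u j k i i' - Bmx v j k i i') = 0.
  under eq_bigr do rewrite sumrB -!qvec_sumE.
  by rewrite sumrB u1// v1// subrr.
(* Writing 0 as the difference of the two masses reduces the claim, term by term, to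
   [1 - expR (- z) <= z] with [z = x i + y i']. *)
move=> H; rewrite -[leLHS]H; apply: ler_sum => i _; apply: ler_sum => i' _.
have -> : Bmx v j k i i' = Bmx u j k i i' * expR (- (x i + y i')).
  rewrite !BmxE /x /y opprD [_ - _]addrC !opprB expRD !expRB !lnK ?posrE//.
  by field; rewrite !gt_eqF.
rewrite -[X in X - _]mulr1 -mulrBr ler_wpM2l//.
  by rewrite BmxE !mulr_ge0 ?gam_ge0// ltW// Kmx_gt0.
by have := expR_ge1Dx (- (x i + y i')); lra.
Qed.

(** Adding the Gibbs sum [G] to the difference with weights [center u] leaves [qvec - center], of
    total mass 0, paired with [ln u - ln v], which stays within [4 * kappa] of a constant by
    flatness of both families. *)
Lemma potential_gap S u v : alternating e S ->
    positive u -> balanced u -> flat u -> unit_mass u ->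
    positive v -> balanced v -> flat v -> unit_mass v ->
  potential u - potential v <= 4 * kappa * bis_error e Gamma mu C eps u.
Proof.
move=> altS u0 u_bal u_flat u1 v0 v_bal v_flat v1.
rewrite (@potentialB _ _ (center u))//; last 2 first.
- by move=> j jG; rewrite /center jG.
- by move=> j k ejk; exact: sum_center ejk.
have G : 0 <= \sum_j \sum_(k in nbhd e j) \sum_i
    qvec u j k i 0 * (ln (u j k i 0) - ln (v j k i 0)).
  rewrite (sum_pairs_split sym_e altS); apply: sumr_ge0 => j _; apply: sumr_ge0 => k.
  by rewrite inE; exact: pair_gibbs.
rewrite -[leLHS]addr0 (le_trans (lerD (lexx _) G))//.
rewrite -big_split bis_errorE mulr_sumr/=; apply: ler_sum => j _.
rewrite -big_split mulr_sumr/=; apply: ler_sum => k; rewrite inE => ejk.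
rewrite -big_split/=.
under eq_bigr do rewrite -[X in _ * X + _]opprB mulrN addrC -mulrBl.
have [c Hc] := u_flat _ _ ejk; have [c' Hc'] := v_flat _ _ ejk.
rewrite [leRHS]mulrC; apply: (@sum_centered_le _ _ _ _ (c - c')).
  by rewrite sumrB u1// (sum_center u1 ejk) subrr.
by move=> i; have := Hc i; have := Hc' i; rewrite !ler_norml; lra.
Qed.

(** The last hypothesis says that the side not updated next carries no error. On [S], passing from
    the mean to the target costs a factor 2, hence 4 after squaring, and Pinsker's inequality
    another 2, whence 8. *)
Lemma error_sqr_le S u : alternating e S ->
    positive u -> balanced u -> unit_mass u ->
    (forall j k i, j \notin S -> e j k -> center u j i 0 = qvec u j k i 0) ->
  bis_error e Gamma mu C eps u ^+ 2 <=
  8 * #|edges e|%:R * (potential u - potential (bis_step S u)).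
Proof.
move=> altS u0 u_bal u1 out; rewrite potential_step// bis_errorE.
rewrite (bigID (mem S))/= [X in _ + X]big1 ?addr0 => [|j jS]; last first.
  rewrite big1// => k; rewrite inE => ejk; rewrite /pairwise_error big1// => i _.
  by rewrite (out _ k)// subrr normr0.
pose D j k := \sum_i `|target u j i 0 - qvec u j k i 0|.
pose KL j k := \sum_i target u j i 0 * (ln (target u j i 0) - ln (qvec u j k i 0)).
have DKL j k : e j k -> D j k ^+ 2 <= 2 * KL j k.
  move=> ejk; apply: pinsker => [i|i|i||].
  - exact: target_ge0.
  - exact: qvec_ge0.
  - exact: target0.
  - exact: sum_target.
  - exact: u1.
have D0 j k : 0 <= D j k by exact: sumr_ge0.
have ED : \sum_(j in S) \sum_(k in nbhd e j) pairwise_error u j k <=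
    2 * \sum_(j in S) \sum_(k in nbhd e j) D j k.
  rewrite mulr_sumr; apply: ler_sum => j _; have [jG|jG] := boolP (j \in Gamma).
    rewrite mulr_sumr; apply: ler_sum => k _; apply: (@le_trans _ _ (D j k)).
      by apply: ler_sum => i _; rewrite /center /target jG distrC.
    by have := D0 j k; lra.
  have := @sum_dist_mean_le R _ _ (nbhd e j) (fun k i => qvec u j k i 0)
    (fun i => target u j i 0).
  congr (_ <= 2 * _); apply: eq_bigr => k _; apply: eq_bigr => i _.
    by rewrite /center (negbTE jG) !mxE summxE.
  by rewrite distrC.
have E0 : 0 <= \sum_(j in S) \sum_(k in nbhd e j) pairwise_error u j k.
  by do 2 (apply: sumr_ge0 => ? _); exact: sumr_ge0.
have CS : (\sum_(j in S) \sum_(k in nbhd e j) D j k) ^+ 2 <=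
    #|edges e|%:R * (2 * \sum_(j in S) \sum_(k in nbhd e j) KL j k).
  rewrite mulr_sumr; under [in leRHS]eq_bigr do rewrite mulr_sumr.
  exact: sum_pairs_sqr_le.
rewrite -[X in _ <= _ * X]/(\sum_(j in S) \sum_(k in nbhd e j) KL j k).
apply: le_trans (_ : _ <= 4 * (\sum_(j in S) \sum_(k in nbhd e j) D j k) ^+ 2) _; last by lra.
rewrite (_ : 4 = 2 ^+ 2) -?exprMn ?ler_pXn2r ?nnegrE//; last by ring.
exact: le_trans ED.
Qed.

End Potential.
End Algorithm.

(** * The iteration count *)

Lemma bipartition_alternating (V : finType) (e : rel V) (S1 S2 : {set V}) :
  is_bipartition e S1 S2 -> alternating e S1 /\ alternating e S2.
Proof.
move=> [_ S12 bip]; have disj j : j \in S1 -> j \in S2 = false.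
  by move=> j1; apply/negP => j2; have := in_set0 j; rewrite -S12 inE j1 j2.
have disj' j : j \in S2 -> j \in S1 = false by apply: contraTF => /disj ->.
split=> j k /bip[[j1 k2]|[j2 k1]].
- by rewrite j1 disj'.
- by rewrite disj' // k1.
- by rewrite disj // k2.
- by rewrite j2 disj.
Qed.

Theorem theorem3p8 (R : realType) (d : nat) (V : finType) (e : rel V)
    (Gamma S1 S2 : {set V}) (mu : V -> 'cV[R]_d) (C : V -> V -> 'M[R]_d)
    (eps : R)
    (tree_e : is_tree e)
    (leafG : forall j, j \in Gamma -> is_leaf e j)
    (nadjG : forall j k, j \in Gamma -> k \in Gamma -> ~~ e j k)
    (bipS : is_bipartition e S1 S2)
    (probmu : forall j, j \in Gamma -> is_prob (mu j))
    (trC : forall j k, e j k -> C k j = (C j k)^T)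
    (eps_gt0 : 0 < eps) :
  forall delta : R, 0 < delta ->
  exists t : nat,
    [/\ (1 <= t)%N,
        t%:R <= 2 + 88 * #|edges e|%:R * Cmax e C / (delta * eps)
      & bis_error e Gamma mu C eps (bis e Gamma mu C eps S1 S2 t) <= delta].
Proof.
move=> delta delta0.
have k0 : 0 <= Cmax e C / eps by exact: kappa_ge0.
have -> : 88 * #|edges e|%:R * Cmax e C / (delta * eps) =
    88 * #|edges e|%:R * (Cmax e C / eps) / delta by field; rewrite !gt_eqF.
have [_ sym_e _ _ _] := tree_e.
set n : R := #|edges e|%:R; set kappa := Cmax e C / eps in k0 *.
have n0 : 0 <= n by exact: ler0n.
have X0 : 0 <= n * kappa / delta by apply: divr_ge0; [exact: mulr_ge0|exact: ltW].
(* In dimension 0 the error is an empty sum; otherwise [ord0] provides the index that the potential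
   needs. *)
case: d => [|d] in mu C probmu trC kappa k0 X0 *.
  exists 1%N; split=> //; first lra.
  rewrite bis_errorE// big1 ?ltW// => j _; rewrite big1// => k _.
  by rewrite /pairwise_error big_ord0.
set u := bis e Gamma mu C eps S1 S2; set err := bis_error _ _ _ _ _.
(* The least natural number above the real bound. If the iterates 1 to [T] all failed,
   [descent_count] would bound [T] by 64/88 of that bound, since 2 * 8 * 4 = 64. *)
pose T := (Num.truncn (88 * n * kappa / delta)).+1.
have X88 : 0 <= 88 * n * kappa / delta by lra.
have TgtX : 88 * n * kappa / delta < T%:R by exact: truncnS_gt.
have TleX : T%:R <= 88 * n * kappa / delta + 1.
  by rewrite /T -natr1 lerD2r truncn_le.
have [/existsP[t et]|] := boolP [exists t : 'I_T, err (u t.+1) <= delta].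
  exists t.+1; split=> //; apply: (@le_trans _ _ T%:R); first by rewrite ler_nat.
  lra.
rewrite negb_exists => /forallP big_err.
have [alt1 alt2] := bipartition_alternating bipS.
pose S t := if odd t then S2 else S1.
have altS t : alternating e (S t) by rewrite /S; case: odd.
have uS t : u t.+1 = bis_step e Gamma mu C eps (S t) (u t) by [].
have inv t : [/\ positive (u t), balanced e Gamma (u t) & flat e C eps (u t)].
  elim: t => [|t [u_gt0 u_bal u_flat]]; last first.
    by rewrite uS; split; [exact: step_gt0|exact: step_balanced|exact: step_flat].
  split=> [j k i|j _|j k _]; first by rewrite mxE ltr01.
    by exists 0 => i; rewrite big1// => k _; rewrite mxE ln1.
  by exists 0 => i; rewrite mxE ln1 subrr normr0 mulr_ge0.
(* Unit mass starts with the first iterate, so the descent is run on [u t.+1]. *)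
have mass t : unit_mass e Gamma mu C eps (u t.+1).
  by rewrite uS; have [? ? _] := inv t; apply: step_unit_mass => //; exact: ord0.
have H : T%:R <= 2 * (8 * n) * (4 * kappa) / delta.
  apply: (@descent_count _ (fun t => err (u t.+1))
    (fun t => potential e Gamma mu ord0 (u t.+1))) => //.
  - by rewrite mulr_ge0.
  - by rewrite mulr_ge0.
  - by move=> t tT; have := big_err (Ordinal tT); rewrite -ltNge.
  - move=> t _; have [? ? _] := inv t.+1; rewrite (uS t.+1); apply: error_sqr_le => //.
    (* The sides alternate: a vertex outside [S t.+1] lies in [S t] and has just been updated. *)
    move=> j k i jS ejk; rewrite uS; have [? ? _] := inv t.
    apply: center_step => //.
    case: bipS => S12 _ _; have := in_setT j; rewrite -S12 inE; move: jS.
    by rewrite /S/=; case: odd => /= /negbTE ->; rewrite ?orbF.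
  - move=> t _; have [? ? ?] := inv t.+1; have [? ? ?] := inv T.+1.
    by apply: (@potential_gap _ _ _ _ _ _ _ _ _ _ _ _ _ S1).
have : 2 * (8 * n) * (4 * kappa) / delta <= 88 * n * kappa / delta by lra.
lra.
Qed.
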